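(* There is a universal constant $c>0$ such that for all distributions $P,Q$ on $\mathcal{X}$ and every $\varepsilon>0$, every $\varepsilon$-differentially private test $K$ that distinguishes $P$ and $Q$ satisfies $$\mathit{SC}^{P,Q}(K)\ge \frac{c}{\varepsilon\tau+H^2(P',Q')}.$$
   Context: Distributions are identified with densities $P(x),Q(x)$. Data sets in $\mathcal{X}^n$ are neighbors if they differ in one entry; a randomized test $K:\mathcal{X}^*\to\{\text{''}P\text{''},\text{''}Q\text{''}\}$ is $\varepsilon$-differentially private if for every $n$, all neighbors $x,x'\in\mathcal{X}^n$ and every output $o$, $\Pr[K(x)=o]\le e^{\varepsilon}\Pr[K(x')=o]$. $\mathrm{adv}_n(K)=\Pr_{x\sim P^n}[K(x)=\text{''}P\text{''}]-\Pr_{x\sim Q^n}[K(x)=\text{''}P\text{''}]$; $\mathit{SC}^{P,Q}(K)$ is the least $n_0$ with $\mathrm{adv}_n(K)\ge2/3$ for all $n\ge n_0$ ($K$ distinguishes $P$ and $Q$ if this is finite). $H^2(P,Q)=\frac12\int(\sqrt{P}-\sqrt{Q})^2$. $\tau=\max\{\int\max\{P-e^{\varepsilon}Q,0\},\int\max\{Q-e^{\varepsilon}P,0\}\}$, and by the paper's standing convention (swap names of $P,Q$ otherwise) $\tau=\int\max\{P(x)-e^{\varepsilon}Q(x),0\}\mathrm{d}x$. $\varepsilon'\in[0,\varepsilon]$ is the largest value with $\int\max\{Q(x)-e^{\varepsilon'}P(x),0\}\mathrm{d}x=\tau$. With $\tilde P=\min\{e^{\varepsilon}Q,P\}$ and $\tilde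 Q=\min\{e^{\varepsilon'}P,Q\}$ pointwise, $P'=\tilde P/(1-\tau)$ and $Q'=\tilde Q/(1-\tau)$. *)

(* Defs.v *)
From HB Require Import structures.
From mathcomp Require Import all_boot all_order all_algebra.
From mathcomp Require Import all_classical all_reals all_analysis.
Set Implicit Arguments. Unset Strict Implicit. Unset Printing Implicit Defensive.
Import Order.TTheory GRing.Theory Num.Theory.
Local Open Scope ring_scope.

Section dp_defs.
Context {R : realType} {d : measure_display} {X : measurableType d}.
Variable mu : {measure set X -> \bar R}.

Definition is_density (P : X -> R) : Prop :=
  [/\ measurable_fun setT P, (forall x, 0 <= P x) &
      (\int[mu]_x (P x)%:E = 1)%E].

Fixpoint prod_expect (P : X -> R) (n : nat) : (n.-tuple X -> R) -> \bar R :=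
  match n return (n.-tuple X -> R) -> \bar R with
  | 0 => fun f => (f [tuple])%:E
  | m.+1 => fun f =>
      (\int[mu]_x ((P x)%:E * prod_expect P (fun t : m.-tuple X => f (cons_tuple x t))))%E
  end.

(* A randomized test K : X^* -> {"P","Q"} is given by k n x = Pr[K(x) = "P"]
   for x in X^n (so Pr[K(x) = "Q"] = 1 - k n x). *)
Definition is_test (k : forall n, n.-tuple X -> R) : Prop :=
  forall n, measurable_fun setT (k n) /\ (forall x, 0 <= k n x <= 1).

Definition neighbors n (x x' : n.-tuple X) : Prop :=
  exists i : 'I_n, forall j : 'I_n, j != i -> tnth x j = tnth x' j.

Definition is_DP (eps : R) (k : forall n, n.-tuple X -> R) : Prop :=
  forall n (x x' : n.-tuple X), neighbors x x' ->
    k n x <= expR eps * k n x' /\ 1 - k n x <= expR eps * (1 - k n x').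

Definition adv (P Q : X -> R) (k : forall n, n.-tuple X -> R) (n : nat) : R :=
  fine (prod_expect P (k n)) - fine (prod_expect Q (k n)).

Definition succeeds_from P Q k (n0 : nat) : Prop :=
  forall n, (n0 <= n)%N -> 2 / 3 <= adv P Q k n.

Definition distinguishes P Q k : Prop := exists n0, succeeds_from P Q k n0.

Definition is_SC P Q k (n0 : nat) : Prop :=
  succeeds_from P Q k n0 /\ forall m, succeeds_from P Q k m -> (n0 <= m)%N.

Definition hockey (A B : X -> R) (e : R) : R :=
  Rintegral mu setT (fun x => Num.max (A x - expR e * B x) 0).

Definition tau (P Q : X -> R) (eps : R) : R :=
  Num.max (hockey P Q eps) (hockey Q P eps).

(* the paper's naming convention: (P,Q) renamed so that
   tau = int max{P - e^eps Q, 0} *)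
Definition nameP (P Q : X -> R) eps : X -> R :=
  if hockey Q P eps <= hockey P Q eps then P else Q.
Definition nameQ (P Q : X -> R) eps : X -> R :=
  if hockey Q P eps <= hockey P Q eps then Q else P.

(* e' is the largest value in [0,eps] with int max{Q - e^{e'} P, 0} = tau
   (P, Q already renamed) *)
Definition is_eps' (P Q : X -> R) (eps e' : R) : Prop :=
  [/\ 0 <= e' <= eps, hockey Q P e' = hockey P Q eps &
      forall e'', 0 <= e'' <= eps -> hockey Q P e'' = hockey P Q eps -> e'' <= e'].

Definition P' (P Q : X -> R) (eps : R) : X -> R :=
  fun x => Num.min (expR eps * Q x) (P x) / (1 - hockey P Q eps).
Definition Q' (P Q : X -> R) (eps e' : R) : X -> R :=
  fun x => Num.min (expR e' * P x) (Q x) / (1 - hockey P Q eps).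

Definition hellinger2 (A B : X -> R) : R :=
  2^-1 * Rintegral mu setT (fun x => (Num.sqrt (A x) - Num.sqrt (B x)) ^+ 2).

End dp_defs.

(* Main.v *)
(** A hybrid argument. Differential privacy makes the acceptance probability of
    the test vary by at most [2 * eps] between neighbors, so replacing the law
    [P] of the samples by [P'] one coordinate at a time changes its mean by at
    most [n * 2 eps * ||P - P'||_1 <= 4 n eps tau], and likewise for [Q] and [Q'].
    Between [P'] and [Q'] the means differ by at most [sqrt (2 n H^2)], because
    the affinity of the product laws is [(1 - H^2) ^ n]. If the total is at
    least [2/3], then [n (eps tau + H^2) >= 1/24]. When [tau = 1] the laws [P']
    and [Q'] degenerate to [0] (division by zero) and the first step is applied
    to [P] and [Q] directly. *)

Require Import Defs.
From HB Require Import structures.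
From mathcomp Require Import all_boot all_order all_algebra.
From mathcomp Require Import all_classical all_reals all_analysis.
From mathcomp Require Import measurable_realfun ring lra.
Set Implicit Arguments. Unset Strict Implicit. Unset Printing Implicit Defensive.
Import Order.TTheory GRing.Theory Num.Theory.
Import numFieldNormedType.Exports.
Local Open Scope classical_set_scope.
Local Open Scope ring_scope.

(** * Integrability of linear combinations of real-valued functions *)

Section integrable_EFin.
Context {R : realType} {d : measure_display} {X : measurableType d}.
Variables (mu : {measure set X -> \bar R}) (f g : X -> R).
Hypothesis fi : mu.-integrable setT (EFin \o f).

Lemma integrableZ_EFin r : mu.-integrable setT (EFin \o (fun x => r * f x)).
Proof. exact: integrableZl fi. Qed.

Hypothesis gi : mu.-integrable setT (EFin \o g).

Lemma integrableD_EFin : mu.-integrable setT (EFin \o (fun x => f x + g x)).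
Proof. exact: (integrableD measurableT fi gi). Qed.

Lemma integrableB_EFin : mu.-integrable setT (EFin \o (fun x => f x - g x)).
Proof. exact: (integrableB measurableT fi gi). Qed.

End integrable_EFin.

(** * Measurability of parameter integrals against a density *)

Section density_sections.
Context {R : realType} {d : measure_display} {X : measurableType d}.
Variables (mu : {measure set X -> \bar R}) (P : X -> R).
Hypothesis dP : is_density mu P.

Lemma density_integrable : mu.-integrable setT (EFin \o P).
Proof.
case: dP => mP P0 iP; apply/integrableP; split; first exact/measurable_EFinP.
by under eq_integral do rewrite /= ger0_norm//; rewrite iP ltry.
Qed.

Let D n := [set x | n.+1%:R^-1 <= P x].

Let mD n : measurable (D n).
Proof.
case: dP => mP _ _; rewrite (_ : D n = setT `&` P @^-1` `[n.+1%:R^-1, +oo[).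
  exact: mP.
by rewrite setTI; apply/seteqP; split=> x /=; rewrite in_itv/= andbT.
Qed.

(** Markov's inequality: [P] has integral 1 and is at least [n.+1%:R^-1] on [D n]. *)
Let D_lty n : (mu (D n) < +oo)%E.
Proof.
case: dP => mP P0 iP.
have n0 : (0 : R) < n.+1%:R^-1 by rewrite invr_gt0.
have := @le_integral_comp_abse _ _ _ mu setT measurableT (EFin \o P) _ id
  (@measurable_id _ _ _) (fun _ r0 => r0) _ _ n0.
rewrite setTI.
have -> : [set x | (n.+1%:R^-1%:E <= `|(EFin \o P) x|)%E] = D n.
  by apply/seteqP; split=> x /=; rewrite lee_fin ger0_norm.
under eq_integral do rewrite /= ger0_norm//.
rewrite iP => /(_ (fun _ _ _ _ => id)) H.
have /H : measurable_fun setT (EFin \o P) by exact/measurable_EFinP.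
rewrite -lee_pdivlMl// mule1 => /le_lt_trans; apply; exact: ltry.
Qed.

(* [mu] need not be sigma-finite, but its restrictions to the superlevel sets
   of [P] are finite, so that Tonelli's theorem applies to each of them. *)
Lemma measurable_density_integral d' (Y : measurableType d') (G : Y * X -> R) :
  measurable_fun setT G -> (forall p, 0 <= G p) ->
  measurable_fun setT (fun y => \int[mu]_x (P x * G (y, x))%:E)%E.
Proof.
case: dP => mP P0 iP mG G0.
pose H (p : Y * X) : \bar R := (P p.2 * G p)%:E.
have mH : measurable_fun setT H.
  by apply/measurable_EFinP/measurable_funM => //; exact: measurableT_comp.
pose Hn n (p : Y * X) : \bar R := (H p * (\1_(D n) p.2)%:E)%E.
have mHn n : measurable_fun setT (Hn n).
  apply: emeasurable_funM => //; apply/measurable_EFinP.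
  by apply: measurableT_comp => //; exact: measurable_indic.
have H0 p : (0 <= H p)%E by rewrite lee_fin mulr_ge0.
have Hn0 n p : (0 <= Hn n p)%E by rewrite mule_ge0// lee_fin.
apply: (emeasurable_fun_cvg (fun n y => \int[mu]_x (Hn n (y, x)))%E).
  move=> n.
  have := @measurable_fun_fubini_tonelli_F _ _ Y X R
    (mfrestr (mD n) (D_lty n)) (Hn n) (mHn n) (Hn0 n).
  apply: eq_measurable_fun => y _; rewrite /fubini_F.
  have HnE (m : {measure set X -> \bar R}) :
      (\int[m]_x Hn n (y, x) = \int[m]_(x in D n) H (y, x))%E.
    rewrite [RHS]integral_mkcond; apply: eq_integral => x _.
    by rewrite /Hn epatch_indic.
  rewrite !HnE; apply: eq_measure_integral => A mA AD.
  by rewrite /= /mfrestr /mrestr setIidl.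
move=> y _.
have Hlim x : Hn n (y, x) @[n --> \oo] --> H (y, x).
  (* Where [P x = 0] both sides vanish; elsewhere [x] lies in [D n] as soon as [n >= (P x)^-1].
     Either way the sequence is eventually constant. *)
  have [Px0|Px0] := eqVneq (P x) 0.
    apply: cvg_near_cst; apply: nearW => n.
    by rewrite /Hn /H/= Px0 mul0r mul0e.
  apply: cvg_near_cst.
  have Px_gt0 : 0 < P x by rewrite lt_def Px0 P0.
  near=> n; rewrite /Hn indicE mem_set ?mule1//= /D/=.
  rewrite -[leRHS]invrK lef_pV2 ?posrE ?invr_gt0// -natr1.
  apply: (@le_trans _ _ n%:R); last by rewrite lerDl.
  by near: n; exact: nbhs_infty_ger.
rewrite (_ : (\int[mu]_x _)%E = (\int[mu]_x limn (fun n => Hn n (y, x)))%E); last first.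
  by apply: eq_integral => x _; apply/esym/cvg_lim => //; exact: Hlim.
apply: cvg_monotone_convergence => //.
- by move=> n; exact: measurable_fun_pair2.
- move=> x _ m n mn; rewrite /Hn lee_wpmul2l//= lee_fin !indicE ler_nat.
  have [|//] := boolP (x \in D m); rewrite !inE /D/= => Dm.
  rewrite mem_set//=; apply: le_trans Dm.
  by rewrite lef_pV2 ?posrE// ler_nat.
Unshelve. all: end_near. Qed.

End density_sections.

(** * Means of functions with values in [[0, 1]], under one law and under product laws *)

Definition unit_fun {R : realType} {d} {T : measurableType d} (f : T -> R) :=
  measurable_fun setT f /\ forall x, 0 <= f x <= 1.

Lemma unit_fun_comp {R : realType} d1 d2 (T1 : measurableType d1)
    (T2 : measurableType d2) (f : T2 -> R) (h : T1 -> T2) :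
  unit_fun f -> measurable_fun setT h -> unit_fun (f \o h).
Proof. by move=> [mf f01] mh; split=> [|x]; [exact: measurableT_comp|exact: f01]. Qed.

Lemma unit_funC {R : realType} d (T : measurableType d) (f : T -> R) :
  unit_fun f -> unit_fun (fun x => 1 - f x).
Proof.
move=> [mf f01]; split=> [|x]; first exact: measurable_funB.
by have := f01 x; lra.
Qed.

Lemma measurable_cons_pair d1 d2 (Y : measurableType d1) (X : measurableType d2) n :
  measurable_fun [set: (Y * X) * n.-tuple X]
    (fun p => (p.1.1, cons_tuple p.1.2 p.2)).
Proof.
apply: measurable_fun_pair; first exact: measurableT_comp.
by apply: measurable_cons => //; exact: measurableT_comp.
Qed.

Lemma measurable_cons_tuple d (X : measurableType d) n (x : X) :
  measurable_fun [set: n.-tuple X] (cons_tuple x).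
Proof. exact: measurable_cons. Qed.

Definition mean {R : realType} {d} {X : measurableType d}
  (mu : {measure set X -> \bar R}) (P g : X -> R) : R :=
  Rintegral mu setT (fun x => P x * g x).

Section mean.
Context {R : realType} {d : measure_display} {X : measurableType d}.
Variable mu : {measure set X -> \bar R}.
Implicit Types P g h : X -> R.

Lemma mean_integrable P g : is_density mu P -> unit_fun g ->
  mu.-integrable setT (EFin \o (fun x => P x * g x)).
Proof.
move=> dP [mg g01]; have [mP P0 _] := dP.
apply: (le_integrable measurableT _ _ (density_integrable dP)).
  exact/measurable_EFinP/measurable_funM.
move=> x _ /=; have /andP[g0 g1] := g01 x.
by rewrite lee_fin !ger0_norm ?mulr_ge0// ler_piMr.
Qed.

Lemma EFin_mean P g : is_density mu P -> unit_fun g ->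
  (\int[mu]_x (P x * g x)%:E = (mean mu P g)%:E)%E.
Proof.
move=> dP ug; rewrite /mean /Rintegral fineK//.
exact: (integrable_fin_num _ (mean_integrable dP ug)).
Qed.

Lemma Rintegral_density P : is_density mu P -> Rintegral mu setT P = 1.
Proof. by move=> [_ _ iP]; rewrite /Rintegral iP. Qed.

Lemma le_meanD P g h s : is_density mu P -> unit_fun g -> unit_fun h ->
  (forall x, g x <= h x + s) -> mean mu P g <= mean mu P h + s.
Proof.
move=> dP ug uh gh; have iP := density_integrable dP.
have -> : s = Rintegral mu setT (fun x => s * P x).
  by rewrite RintegralZl// Rintegral_density// mulr1.
have isP : mu.-integrable setT (EFin \o (fun x => s * P x)).
  exact: integrableZ_EFin.
rewrite /mean -RintegralD//; last exact: mean_integrable.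
apply: le_Rintegral => //; first exact: mean_integrable.
  by apply: integrableD_EFin => //; exact: mean_integrable.
by move=> x _; rewrite [s * _]mulrC -mulrDr ler_wpM2l//; case: dP.
Qed.

Lemma mean_01 P g : is_density mu P -> unit_fun g -> 0 <= mean mu P g <= 1.
Proof.
move=> dP ug; have [mP P0 iP] := dP; have [mg g01] := ug.
apply/andP; split.
  by apply: Rintegral_ge0 => x _; rewrite mulr_ge0//; case/andP: (g01 x).
rewrite -(Rintegral_density dP); apply: le_Rintegral => //.
- exact: mean_integrable.
- exact: density_integrable.
- by move=> x _; rewrite ler_piMr//; case/andP: (g01 x).
Qed.

Lemma meanC P g : is_density mu P -> unit_fun g ->
  mean mu P (fun x => 1 - g x) = 1 - mean mu P g.
Proof.
move=> dP ug; rewrite -[in RHS](Rintegral_density dP) -RintegralB//.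
- by apply: eq_Rintegral => x _; ring.
- exact: density_integrable.
- exact: mean_integrable.
Qed.

Lemma unit_fun_mean P d' (Y : measurableType d') (G : Y * X -> R) :
  is_density mu P -> unit_fun G -> unit_fun (fun y => mean mu P (fun x => G (y, x))).
Proof.
move=> dP [mG G01]; have uG y : unit_fun (fun x => G (y, x)).
  by split=> // ; exact: measurable_fun_pair2.
split=> [|y]; last exact: mean_01.
apply/measurable_EFinP.
have := measurable_density_integral dP mG (fun p => proj1 (andP (G01 p))).
by apply: eq_measurable_fun => y _; rewrite EFin_mean.
Qed.

(** Each inner expectation must be finite, and measurable in the variable integrated next. The
    induction therefore ranges over all parameter spaces: [Y] becomes [Y * X], which absorbs the
    first sample. *)
Lemma prod_expect_section P n : is_density mu P ->
  forall d' (Y : measurableType d') (F : Y -> n.-tuple X -> R),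
  unit_fun (fun p : Y * n.-tuple X => F p.1 p.2) ->
  exists2 g : Y -> R, unit_fun g & forall y, prod_expect mu P (F y) = (g y)%:E.
Proof.
move=> dP; elim: n => [|n IH] d' Y F uF.
  exists (fun y => F y [tuple]) => //.
  by apply: (unit_fun_comp (h := fun y => (y, [tuple])) uF); exact: pair2_measurable.
have [g ug gE] := IH _ (Y * X)%type (fun p t => F p.1 (cons_tuple p.2 t))
  (unit_fun_comp uF (@measurable_cons_pair _ _ Y X n)).
exists (fun y => mean mu P (fun x => g (y, x))); first exact: unit_fun_mean.
move=> y /=; rewrite -EFin_mean//; last first.
  by apply: (unit_fun_comp ug); exact: pair1_measurable.
by apply: eq_integral => x _; rewrite (gE (y, x)).
Qed.

Definition prod_mean P n (f : n.-tuple X -> R) : R := fine (prod_expect mu P f).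

Section prod_mean_theory.
Variable P : X -> R.
Hypothesis dP : is_density mu P.

Lemma unit_fun_cons n (f : n.+1.-tuple X -> R) x :
  unit_fun f -> unit_fun (fun t => f (cons_tuple x t)).
Proof. by move=> uf; apply: (unit_fun_comp uf); exact: measurable_cons_tuple. Qed.

Lemma unit_fun_prod_mean n (f : n.+1.-tuple X -> R) : unit_fun f ->
  unit_fun (fun x => prod_mean P (fun t => f (cons_tuple x t))).
Proof.
move=> uf.
have [|g ug gE] := prod_expect_section dP (F := fun x t => f (cons_tuple x t)).
  by apply: (unit_fun_comp (h := fun p => cons_tuple p.1 p.2) uf); exact: measurable_cons.
by rewrite (_ : (fun x => _) = g)//; apply/funext => x; rewrite /prod_mean gE.
Qed.

Lemma prod_meanS n (f : n.+1.-tuple X -> R) : unit_fun f ->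
  prod_mean P f = mean mu P (fun x => prod_mean P (fun t => f (cons_tuple x t))).
Proof.
move=> uf.
have [|g ug gE] := prod_expect_section dP (F := fun x t => f (cons_tuple x t)).
  by apply: (unit_fun_comp (h := fun p => cons_tuple p.1 p.2) uf); exact: measurable_cons.
rewrite /prod_mean/= /mean /Rintegral; congr fine; apply: eq_integral => x _.
by rewrite gE.
Qed.

Lemma prod_mean_01 n (f : n.-tuple X -> R) : unit_fun f -> 0 <= prod_mean P f <= 1.
Proof.
case: n f => [|n] f uf; first by case: uf => _; exact.
by rewrite prod_meanS//; apply: mean_01 => //; exact: unit_fun_prod_mean.
Qed.

Lemma le_prod_mean n (f g : n.-tuple X -> R) s : unit_fun f -> unit_fun g ->
  (forall t, f t <= g t + s) -> prod_mean P f <= prod_mean P g + s.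
Proof.
elim: n f g => [|n IH] f g uf ug fg; first exact: fg.
rewrite !prod_meanS//; apply: le_meanD => //; try exact: unit_fun_prod_mean.
by move=> x; apply: IH => //; exact: unit_fun_cons.
Qed.

End prod_mean_theory.
End mean.

(** * Replacing the law of the samples one coordinate at a time *)

Lemma neighbors_cons d (X : measurableType d) n (x y : X) (t : n.-tuple X) :
  neighbors (cons_tuple x t) (cons_tuple y t).
Proof.
exists ord0 => j j0; have [k ->] : exists k, j = lift ord0 k.
  by have [k|] := unliftP ord0 j; [exists k|move=> j0'; rewrite j0' eqxx in j0].
by rewrite !tnthS.
Qed.

Lemma neighbors_consr d (X : measurableType d) n (x : X) (t t' : n.-tuple X) :
  neighbors t t' -> neighbors (cons_tuple x t) (cons_tuple x t').
Proof.
move=> [i tt']; exists (lift ord0 i) => j ji.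
have [k jE|->//] := unliftP ord0 j; rewrite jE !tnthS tt'//.
by apply: contraNneq ji => ki; rewrite jE ki.
Qed.

(** For densities, this is twice the total variation distance. *)
Definition L1dist {R : realType} {d} {X : measurableType d}
    (mu : {measure set X -> \bar R}) (A B : X -> R) : R :=
  Rintegral mu setT (fun x => `|A x - B x|).

Section L1dist.
Context {R : realType} {d : measure_display} {X : measurableType d}.
Variables (mu : {measure set X -> \bar R}) (A B : X -> R).
Hypotheses (dA : is_density mu A) (dB : is_density mu B).

Let iAB : mu.-integrable setT (EFin \o (fun x => A x - B x)).
Proof.
exact: integrableB_EFin (density_integrable dA) (density_integrable dB).
Qed.

(** Since [A - B] has integral 0, subtracting the constant [g0] from [g] leaves the difference of
    the means unchanged, so only the oscillation of [g] matters. *)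
Lemma mean_L1dist g s : unit_fun g -> (forall x y, `|g x - g y| <= s) ->
  `|mean mu A g - mean mu B g| <= s * L1dist mu A B.
Proof.
move=> ug gs; pose g0 := g point; have [mg g01] := ug.
have [mA _ _] := dA; have [mB _ _] := dB.
have iABg : mu.-integrable setT (EFin \o (fun x => A x * g x - B x * g x)).
  by apply: integrableB_EFin; exact: mean_integrable.
have iABg0 : mu.-integrable setT (EFin \o (fun x => g0 * (A x - B x))).
  exact: integrableZ_EFin.
have -> : mean mu A g - mean mu B g =
    Rintegral mu setT (fun x => (A x * g x - B x * g x) - g0 * (A x - B x)).
  rewrite RintegralB// RintegralZl//.
  rewrite (RintegralB measurableT (mean_integrable dA ug) (mean_integrable dB ug)).
  rewrite (RintegralB measurableT (density_integrable dA) (density_integrable dB)).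
  by rewrite (Rintegral_density dA) (Rintegral_density dB) subrr mulr0 subr0.
have iAg : mu.-integrable setT
    (EFin \o (fun x => (A x * g x - B x * g x) - g0 * (A x - B x))).
  exact: integrableB_EFin.
apply: le_trans (le_normr_Rintegral _ iAg) _ => //.
rewrite /L1dist -RintegralZl//; last exact: (integrable_norm iAB).
apply: le_Rintegral => //.
- exact: (integrable_norm iAg).
- exact: integrableZ_EFin (integrable_norm iAB) _.
- move=> x _; have -> : A x * g x - B x * g x - g0 * (A x - B x) =
      (g x - g0) * (A x - B x) by ring.
  by rewrite normrM ler_wpM2r // gs.
Qed.

(** The difference is split through the mean of [b] under [A]. Passing from [a] to [b] is the
    induction hypothesis for each fixed first sample; changing the law of the first sample is
    [mean_L1dist] applied to [b]. *)
Lemma prod_mean_L1dist n (f : n.-tuple X -> R) s : unit_fun f ->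
  (forall t t', neighbors t t' -> `|f t - f t'| <= s) ->
  `|prod_mean mu A f - prod_mean mu B f| <= n%:R * s * L1dist mu A B.
Proof.
elim: n f => [|n IH] f uf fs; first by rewrite /prod_mean/= subrr normr0 !mul0r.
rewrite !prod_meanS//.
set a := (fun x => prod_mean mu A _); set b := (fun x => prod_mean mu B _).
have ua : unit_fun a by exact: unit_fun_prod_mean.
have ub : unit_fun b by exact: unit_fun_prod_mean.
have ab x : `|a x - b x| <= n%:R * s * L1dist mu A B.
  by apply: IH => [|t t' tt']; [exact: unit_fun_cons|apply: fs; exact: neighbors_consr].
(* Data sets that differ only in the first sample are neighbors, so [b] inherits the oscillation
   bound of [f]. *)
have bs x y : `|b x - b y| <= s.
  have bD u v : b u <= b v + s.
    apply: le_prod_mean => //; try exact: unit_fun_cons.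
    move=> t; have := fs _ _ (neighbors_cons u v t); rewrite ler_norml; lra.
  by have := bD x y; have := bD y x; rewrite ler_norml; lra.
have {}bs := mean_L1dist ub bs.
have ab1 : mean mu A a <= mean mu A b + n%:R * s * L1dist mu A B.
  by apply: le_meanD => // x; have := ab x; rewrite ler_norml; lra.
have ab2 : mean mu A b <= mean mu A a + n%:R * s * L1dist mu A B.
  by apply: le_meanD => // x; have := ab x; rewrite ler_norml; lra.
rewrite -natr1 !mulrDl mul1r; move: bs; rewrite !ler_norml; lra.
Qed.

End L1dist.

(** * Affinity and Hellinger distance of product laws *)

Lemma sqrtrM_le_halfD {R : rcfType} (u v : R) : 0 <= u -> 0 <= v ->
  2 * Num.sqrt (u * v) <= u + v.
Proof.
move=> u0 v0; rewrite -ler_sqr ?nnegrE ?addr_ge0 ?mulr_ge0 ?sqrtr_ge0//.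
rewrite exprMn sqr_sqrtr ?mulr_ge0//.
by have := sqr_ge0 (u - v); lra.
Qed.

Lemma measurable_sqrt_fun {R : realType} d (X : measurableType d) (f : X -> R) :
  measurable_fun setT f -> measurable_fun setT (fun x => Num.sqrt (f x)).
Proof.
move=> mf; apply: (measurableT_comp (f := @Num.sqrt R)) => //.
by apply: continuous_measurable_fun => x; exact: sqrt_continuous.
Qed.

Section affinity.
Context {R : realType} {d : measure_display} {X : measurableType d}.
Variable mu : {measure set X -> \bar R}.
Implicit Types u v A B : X -> R.

Lemma sqrtrM_integrable u v :
  (forall x, 0 <= u x) -> (forall x, 0 <= v x) ->
  mu.-integrable setT (EFin \o u) -> mu.-integrable setT (EFin \o v) ->
  mu.-integrable setT (EFin \o (fun x => Num.sqrt (u x * v x))).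
Proof.
move=> u0 v0 iu iv.
have mu' : measurable_fun setT u by apply/measurable_EFinP/(measurable_int _ iu).
have mv' : measurable_fun setT v by apply/measurable_EFinP/(measurable_int _ iv).
apply: (le_integrable measurableT _ _ (integrableD_EFin iu iv)).
  by apply/measurable_EFinP/measurable_sqrt_fun/measurable_funM.
move=> x _ /=; rewrite lee_fin !ger0_norm ?sqrtr_ge0 ?addr_ge0//.
have := sqrtrM_le_halfD (u0 x) (v0 x); have := sqrtr_ge0 (u x * v x); lra.
Qed.

(** A discriminant argument: integrating the arithmetic-geometric mean inequality for [t ^+ 2 * u x]
    and [v x] shows that [t ^+ 2 * U - 2 * t * W + V] is nonnegative for every [t > 0]. *)
Lemma Rintegral_cauchy_schwarz u v :
  (forall x, 0 <= u x) -> (forall x, 0 <= v x) ->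
  mu.-integrable setT (EFin \o u) -> mu.-integrable setT (EFin \o v) ->
  Rintegral mu setT (fun x => Num.sqrt (u x * v x)) <=
  Num.sqrt (Rintegral mu setT u * Rintegral mu setT v).
Proof.
move=> u0 v0 iu iv; set W := Rintegral _ _ _.
set U := Rintegral mu setT u; set V := Rintegral mu setT v.
have U0 : 0 <= U by exact: Rintegral_ge0.
have V0 : 0 <= V by exact: Rintegral_ge0.
have W0 : 0 <= W by apply: Rintegral_ge0 => x _; exact: sqrtr_ge0.
have iw := sqrtrM_integrable u0 v0 iu iv.
have tW t : 0 < t -> 2 * t * W <= t ^+ 2 * U + V.
  move=> t0; rewrite /W /U /V -!RintegralZl// -RintegralD//; last exact: integrableZ_EFin.
  apply: le_Rintegral => //; first exact: integrableZ_EFin.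
    by apply: integrableD_EFin => //; exact: integrableZ_EFin.
  move=> x _; have tu0 : 0 <= t ^+ 2 * u x by rewrite mulr_ge0// sqr_ge0.
  apply: le_trans (sqrtrM_le_halfD tu0 (v0 x)).
  rewrite -[t ^+ 2 * _ * _]mulrA [X in _ <= 2 * X]sqrtrM ?sqr_ge0//.
  by rewrite sqrtr_sqr gtr0_norm// mulrA.
rewrite -[leLHS]ger0_norm// -sqrtr_sqr ler_wsqrtr//.
have [->|W_neq0] := eqVneq W 0; first by rewrite expr0n mulr_ge0.
have W_gt0 : 0 < W by rewrite lt_def W_neq0.
have [U00|U_neq0] := eqVneq U 0.
  (* The quadratic is now affine in [t], and this choice would give [2 * (V + 1) <= V]. *)
  have := tW ((V + 1) / W); rewrite U00 mulr0 add0r divr_gt0 ?ltr_wpDl// => /(_ isT).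
  by rewrite -mulrA divfK// => h; exfalso; lra.
have U_gt0 : 0 < U by rewrite lt_def U_neq0.
(* [W / U] is the minimizer of the quadratic; the bound there reads [W ^+ 2 / U <= V]. *)
have := tW (W / U) (divr_gt0 W_gt0 U_gt0).
have -> : (W / U) ^+ 2 * U = W ^+ 2 / U by field.
have -> : 2 * (W / U) * W = 2 * (W ^+ 2 / U) by field.
by move=> h; rewrite -ler_pdivrMl// mulrC; lra.
Qed.

(** The Bhattacharyya coefficient. *)
Definition affinity A B : R := Rintegral mu setT (fun x => Num.sqrt (A x * B x)).

Section densities.
Variables A B : X -> R.
Hypotheses (dA : is_density mu A) (dB : is_density mu B).

Let A0 x : 0 <= A x. Proof. by case: dA. Qed.
Let B0 x : 0 <= B x. Proof. by case: dB. Qed.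
Let iA := density_integrable dA.
Let iB := density_integrable dB.
Let iAB := sqrtrM_integrable A0 B0 iA iB.

Lemma affinity_01 : 0 <= affinity A B <= 1.
Proof.
rewrite Rintegral_ge0/= => [|x _]; last exact: sqrtr_ge0.
apply: le_trans (Rintegral_cauchy_schwarz A0 B0 iA iB) _.
by rewrite (Rintegral_density dA) (Rintegral_density dB) mulr1 sqrtr1.
Qed.

Lemma hellinger2_affinity : hellinger2 mu A B = 1 - affinity A B.
Proof.
rewrite /hellinger2.
rewrite (@eq_Rintegral _ _ _ _ _ (fun x => (A x + B x) - 2 * Num.sqrt (A x * B x))).
  rewrite RintegralB//; [|exact: integrableD_EFin|exact: integrableZ_EFin].
  rewrite RintegralZl// RintegralD//.
  rewrite (Rintegral_density dA) (Rintegral_density dB) -/(affinity A B); lra.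
by move=> x _; rewrite sqrtrM// sqrrB !sqr_sqrtr//; ring.
Qed.

(* The data-processing inequality for the Bhattacharyya coefficient. *)
Lemma affinity_prod_mean n (f : n.-tuple X -> R) : unit_fun f ->
  affinity A B ^+ n <=
  Num.sqrt (prod_mean mu A f * prod_mean mu B f) +
  Num.sqrt ((1 - prod_mean mu A f) * (1 - prod_mean mu B f)).
Proof.
elim: n f => [|n IH] f uf.
  rewrite /prod_mean/= expr0; have [_ /(_ [tuple])/andP[f0 f1]] := uf.
  rewrite -!expr2 !sqrtr_sqr !ger0_norm ?subr_ge0//; lra.
rewrite !prod_meanS//.
set a := (fun x => prod_mean mu A _); set b := (fun x => prod_mean mu B _).
have ua : unit_fun a by exact: unit_fun_prod_mean.
have ub : unit_fun b by exact: unit_fun_prod_mean.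
have ua' := unit_funC ua; have ub' := unit_funC ub.
have M0 C g x : is_density mu C -> unit_fun g -> 0 <= C x * g x.
  by move=> [_ C0 _] [_ g01]; rewrite mulr_ge0//; case/andP: (g01 x).
rewrite -!meanC//.
(* To be used twice: with [a], [b] for acceptance and with [1 - a], [1 - b] for rejection. *)
have CS g h : unit_fun g -> unit_fun h ->
    mu.-integrable setT (EFin \o (fun x => Num.sqrt (A x * g x * (B x * h x)))) /\
    Rintegral mu setT (fun x => Num.sqrt (A x * g x * (B x * h x))) <=
    Num.sqrt (mean mu A g * mean mu B h).
  move=> ug uh; have M0A x := M0 _ _ x dA ug; have M0B x := M0 _ _ x dB uh.
  have iAg := mean_integrable dA ug; have iBh := mean_integrable dB uh.
  by split; [exact: sqrtrM_integrable|exact: Rintegral_cauchy_schwarz].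
have [i1 CS1] := CS _ _ ua ub; have [i2 CS2] := CS _ _ ua' ub'.
apply: le_trans (lerD CS1 CS2); rewrite -RintegralD//.
rewrite exprSr /affinity -RintegralZl//; apply: le_Rintegral => //.
- exact: integrableZ_EFin.
- exact: integrableD_EFin.
(* The factor [Num.sqrt (A x * B x)] comes out of both roots; what remains is the induction
   hypothesis for the test with first sample [x]. *)
move=> x _; rewrite ![_ * _ * (B x * _)]mulrACA.
rewrite ![Num.sqrt (A x * B x * _)]sqrtrM ?mulr_ge0// -mulrDr mulrC.
by rewrite ler_wpM2l ?sqrtr_ge0//; apply: IH; exact: unit_fun_cons.
Qed.

(** Squaring the data-processing inequality gives [(a - b) ^+ 2 <= 1 - (r ^+ n) ^+ 2], where [r] is
    the affinity. The right side is at most [2 * (1 - r ^+ n)], hence at most [2 * n%:R * (1 - r)]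
    by Bernoulli's inequality. *)
Lemma prod_mean_hellinger n (f : n.-tuple X -> R) : unit_fun f ->
  (prod_mean mu A f - prod_mean mu B f) ^+ 2 <= 2 * n%:R * hellinger2 mu A B.
Proof.
move=> uf; have := affinity_prod_mean uf.
have := prod_mean_01 dA uf; have := prod_mean_01 dB uf.
set a := prod_mean mu A f; set b := prod_mean mu B f => /andP[b0 b1] /andP[a0 a1].
rewrite hellinger2_affinity; have := affinity_01.
move: (affinity A B) => r /andP[r0 r1].
have rn0 : 0 <= r ^+ n by rewrite exprn_ge0.
have bernoulli : 1 - n%:R * (1 - r) <= r ^+ n.
  elim: (n) => [|m IHm]; first by rewrite mul0r subr0 expr0.
  have rm1 : r ^+ m <= 1 by rewrite exprn_ile1.
  rewrite exprS -natr1; nra.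
set w := Num.sqrt (a * b); set z := Num.sqrt _ => rwz.
have w0 : 0 <= w by exact: sqrtr_ge0.
have z0 : 0 <= z by exact: sqrtr_ge0.
have w2 : w ^+ 2 = a * b by rewrite sqr_sqrtr// mulr_ge0.
have z2 : z ^+ 2 = (1 - a) * (1 - b) by rewrite sqr_sqrtr// mulr_ge0// subr_ge0.
(* Regrouping [w * z] as the geometric mean of [a * (1 - a)] and [b * (1 - b)] makes the bound on
   [(w + z) ^+ 2] collapse to exactly [1 - (a - b) ^+ 2]. *)
have wz : 2 * (w * z) <= a * (1 - a) + b * (1 - b).
  have -> : w * z = Num.sqrt ((a * (1 - a)) * (b * (1 - b))).
    by rewrite -sqrtrM ?mulr_ge0//; congr Num.sqrt; ring.
  by apply: sqrtrM_le_halfD; rewrite mulr_ge0// subr_ge0.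
have rwz2 : (r ^+ n) ^+ 2 <= (w + z) ^+ 2.
  by rewrite ler_sqr ?nnegrE ?addr_ge0.
have rn2 : 2 * r ^+ n - 1 <= (r ^+ n) ^+ 2 by have := sqr_ge0 (r ^+ n - 1); lra.
move: rwz2; rewrite sqrrD w2 z2; lra.
Qed.

End densities.
End affinity.

(** * From privacy to an additive sensitivity bound *)

Lemma neighbors_sym d (X : measurableType d) n (x y : n.-tuple X) :
  neighbors x y -> neighbors y x.
Proof. by move=> [i xy]; exists i => j /xy. Qed.

(** For [eps > 1 / 2] the bound exceeds 1 and is trivial; otherwise [expR eps - 1 <= 2 * eps] turns
    the multiplicative bound into an additive one. *)
Lemma is_DP_dist {R : realType} d (X : measurableType d) (eps : R)
    (k : forall n, n.-tuple X -> R) n (x y : n.-tuple X) :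
  0 < eps -> is_test k -> is_DP eps k -> neighbors x y ->
  `|k n x - k n y| <= 2 * eps.
Proof.
move=> eps0 tk dpk xy; have [_ k01] := tk n.
have := k01 x; have := k01 y.
have [+ _] := dpk _ _ _ xy; have [+ _] := dpk _ _ _ (neighbors_sym xy).
move=> kyx kxy /andP[ky0 ky1] /andP[kx0 kx1]; rewrite ler_norml.
have [eps_gt|eps_le] := ltP (1 / 2) eps; first by lra.
have e1 : 1 <= expR eps by have := expR_ge1Dx eps; lra.
have e2 : expR eps <= 1 + 2 * eps.
  (* This is [1 - eps <= expR (- eps)]. It yields [e2] because [(1 - eps) * (1 + 2 * eps) >= 1] for
     [eps] between 0 and [1 / 2]. *)
  have e3 : expR eps * (1 - eps) <= 1.
    rewrite -[leRHS]expR0 -(subrr eps) expRD ler_pM2l ?expR_gt0//.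
    exact: expR_ge1Dx.
  nra.
apply/andP; split; nra.
Qed.

(** * Truncating one density at a multiple of another *)

Section truncation.
Context {R : realType} {d : measure_display} {X : measurableType d}.
Variables (mu : {measure set X -> \bar R}) (A B : X -> R) (e : R).
Hypotheses (dA : is_density mu A) (dB : is_density mu B).

Let t := hockey mu A B e.
Let excess x := Num.max (A x - expR e * B x) 0.
Let trunc x := Num.min (expR e * B x) (A x).

Let A0 x : 0 <= A x. Proof. by case: dA. Qed.
Let cB0 x : 0 <= expR e * B x.
Proof. by rewrite mulr_ge0 ?expR_ge0//; case: dB. Qed.

Let excess_ge0 x : 0 <= excess x.
Proof. by rewrite le_max lexx orbT. Qed.

Let truncE x : trunc x = A x - excess x.
Proof. by rewrite /trunc /excess maxEle minEle; case: ifP; case: ifP; lra. Qed.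

Let trunc_ge0 x : 0 <= trunc x.
Proof. by rewrite le_min A0 cB0. Qed.

Let excess_integrable : mu.-integrable setT (EFin \o excess).
Proof.
have [mA _ _] := dA; have [mB _ _] := dB.
apply: (le_integrable measurableT _ _ (density_integrable dA)).
  apply/measurable_EFinP; apply: measurable_maxr => //.
  by apply: measurable_funB => //; exact: measurable_funM.
move=> x _ /=; rewrite lee_fin !ger0_norm//.
by have := trunc_ge0 x; rewrite truncE; lra.
Qed.

Let iA := density_integrable dA.

Let trunc_integrable : mu.-integrable setT (EFin \o trunc).
Proof.
rewrite (_ : trunc = fun x => A x - excess x); first exact: integrableB_EFin.
by apply/funext => x; exact: truncE.
Qed.

Let Rintegral_trunc : Rintegral mu setT trunc = 1 - t.
Proof.
rewrite (_ : trunc = fun x => A x - excess x).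
  by rewrite RintegralB// (Rintegral_density dA).
by apply/funext => x; exact: truncE.
Qed.

Lemma hockey_ge0 : 0 <= hockey mu A B e.
Proof. by apply: Rintegral_ge0 => x _; exact: excess_ge0. Qed.

Lemma hockey_le1 : hockey mu A B e <= 1.
Proof. by rewrite -subr_ge0 -Rintegral_trunc; apply: Rintegral_ge0 => x _; exact: trunc_ge0. Qed.

(** Truncation removes exactly the mass [t], so dividing by [1 - t] restores total mass 1. *)
Lemma P'_density : hockey mu A B e < 1 -> is_density mu (P' mu A B e).
Proof.
move=> t1; have t1' : 0 < 1 - t by rewrite subr_gt0.
have -> : P' mu A B e = (fun x => (1 - t)^-1 * trunc x).
  by apply/funext => x; rewrite mulrC.
have iP' := integrableZ_EFin trunc_integrable (1 - t)^-1.
split.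
- by apply/measurable_EFinP; exact: (measurable_int _ iP').
- by move=> x; rewrite mulr_ge0// invr_ge0 ltW.
- rewrite -[LHS]fineK; last exact: (integrable_fin_num _ iP').
  rewrite -/(Rintegral mu setT _) RintegralZl// Rintegral_trunc mulVf//.
  by rewrite gt_eqF.
Qed.

(** As [trunc] is [1 - t] times the truncated law, [A] minus that law equals [excess] minus [t]
    times that law, and both of these terms have integral [t]. *)
Lemma L1dist_P' : hockey mu A B e < 1 ->
  L1dist mu A (P' mu A B e) <= 2 * hockey mu A B e.
Proof.
move=> t1; have dP' := P'_density t1; have iP' := density_integrable dP'.
have t0 := hockey_ge0.
have -> : 2 * hockey mu A B e =
    Rintegral mu setT (fun x => excess x + t * P' mu A B e x).
  rewrite RintegralD//; last exact: integrableZ_EFin.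
  by rewrite RintegralZl// (Rintegral_density dP') -/(hockey mu A B e) /t; lra.
apply: le_Rintegral => //.
- exact: (integrable_norm (integrableB_EFin iA iP')).
- by apply: integrableD_EFin => //; exact: integrableZ_EFin.
move=> x _; have PT : (1 - t) * P' mu A B e x = trunc x.
  by rewrite mulrC divfK// subr_eq0 gt_eqF.
have P0 : 0 <= P' mu A B e x by case: dP'.
have := truncE x; have := excess_ge0 x; rewrite -PT.
have tP : 0 <= t * P' mu A B e x by rewrite mulr_ge0.
by rewrite ler_norml; lra.
Qed.

End truncation.

(** If [u <= 1 / 24], the two replacements cost at most [8 * u <= 1 / 3] of the gap [2 / 3]. Then
    [|p - q| >= 1 / 3], which forces [h >= 1 / 18]. *)
Lemma distance_gap {R : realFieldType} (a b p q u h : R) :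
  2 / 3 <= `|a - b| -> `|a - p| <= 4 * u -> `|b - q| <= 4 * u ->
  (p - q) ^+ 2 <= 2 * h -> 0 <= u -> 0 <= h -> 1 / 24 <= u + h.
Proof.
move=> ab ap bq pqh u0 h0.
have [ub|ub] := leP (1 / 24) u; first by lra.
have pq : 1 / 3 <= `|p - q|.
  have := ler_distD p a b; have := ler_distD q p b; rewrite (distrC q b).
  move: `|a - b| `|a - p| `|b - q| `|p - q| `|p - b| ab ap bq => *; lra.
have : (1 / 3) ^+ 2 <= (p - q) ^+ 2.
  by rewrite -[leRHS]real_normK ?num_real// ler_sqr ?nnegrE//; lra.
lra.
Qed.

(** * The rate forced by a constant advantage *)

Section adv_bound.
Context {R : realType} {d : measure_display} {X : measurableType d}.
Variables (mu : {measure set X -> \bar R}) (A B : X -> R) (eps e' : R).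
Variable k : forall n, n.-tuple X -> R.
Hypotheses (dA : is_density mu A) (dB : is_density mu B).
Hypotheses (eps0 : 0 < eps) (tk : is_test k) (dpk : is_DP eps k).
Hypothesis e'E : hockey mu B A e' = hockey mu A B eps.

Let D := eps * hockey mu A B eps + hellinger2 mu (P' mu A B eps) (Q' mu A B eps e').

Lemma rate_ge0 : 0 <= D.
Proof.
rewrite addr_ge0 ?mulr_ge0 ?invr_ge0 ?hockey_ge0 ?(ltW eps0)//.
by apply: Rintegral_ge0 => x _; exact: sqr_ge0.
Qed.

Lemma adv_rate n : 2 / 3 <= `|prod_mean mu A (@k n) - prod_mean mu B (@k n)| ->
  1 / 24 <= n%:R * D.
Proof.
move=> adv23; have uk : unit_fun (@k n) by exact: tk.
have kD (t t' : n.-tuple X) : neighbors t t' -> `|k t - k t'| <= 2 * eps by exact: is_DP_dist.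
have n0 : (0 : R) <= n%:R by exact: ler0n.
have [t1|t1] := ltP (hockey mu A B eps) 1; last first.
  have {}t1 : hockey mu A B eps = 1 by apply/le_anti; rewrite hockey_le1.
  (* The normalizer is [0], whose inverse is [0] by convention, so both truncated laws vanish and
     only the [eps] term remains. The trivial distance bound 2 then gives [n%:R * eps >= 1 / 6]. *)
  have H0 : hellinger2 mu (P' mu A B eps) (Q' mu A B eps e') = 0.
    rewrite /hellinger2 (_ : (fun x => _) = cst 0).
      by rewrite /Rintegral integral0 mulr0.
    by apply/funext => x; rewrite /P' /Q' t1 subrr invr0 !mulr0 subrr expr0n.
  have AB2 : L1dist mu A B <= 2.
    rewrite -[2]/(1 + 1) -{1}(Rintegral_density dA) -(Rintegral_density dB).
    have iA := density_integrable dA; have iB := density_integrable dB.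
    rewrite -RintegralD//; apply: le_Rintegral => //.
    - exact: (integrable_norm (integrableB_EFin iA iB)).
    - exact: integrableD_EFin.
    - move=> x _; case: dA => _ /(_ x) A0 _; case: dB => _ /(_ x) B0 _.
      by rewrite ler_norml; lra.
  have ne0 : 0 <= n%:R * (2 * eps) by rewrite !mulr_ge0// ltW.
  have := le_trans (prod_mean_L1dist dA dB uk kD) (ler_wpM2l ne0 AB2).
  by rewrite /D H0 t1 mulr1 addr0; move: adv23; lra.
have t1' : hockey mu B A e' < 1 by rewrite e'E.
(* By [e'E] the two normalizers agree, so [Q'] is the truncation of [B] at [expR e' * A] and the
   results on [P'] apply with the roles exchanged. *)
have Q'E : Q' mu A B eps e' = P' mu B A e' by rewrite /Q' /P' e'E.
rewrite /D Q'E; set P1 := P' mu A B eps; set Q1 := P' mu B A e'.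
have dP1 : is_density mu P1 by exact: P'_density.
have dQ1 : is_density mu Q1 by exact: P'_density.
have := prod_mean_L1dist dA dP1 uk kD; have := L1dist_P' dA dB t1.
have := prod_mean_L1dist dB dQ1 uk kD; have := L1dist_P' dB dA t1'.
have := prod_mean_hellinger dP1 dQ1 uk.
rewrite e'E -/P1 -/Q1; move: adv23.
set a := prod_mean mu A _; set b := prod_mean mu B _.
set p := prod_mean mu P1 _; set q := prod_mean mu Q1 _.
set H := hellinger2 _ _ _; set t := hockey _ _ _ _ => ab pqH LB bq LA ap.
have H0 : 0 <= n%:R * H.
  rewrite mulr_ge0// mulr_ge0 ?invr_ge0//.
  by apply: Rintegral_ge0 => x _; exact: sqr_ge0.
have nt0 : 0 <= n%:R * (eps * t) by rewrite !mulr_ge0 ?hockey_ge0// ltW.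
have ne0 : 0 <= n%:R * (2 * eps) by rewrite !mulr_ge0// ltW.
have n4E : n%:R * (2 * eps) * (2 * t) = 4 * (n%:R * (eps * t)) by ring.
rewrite mulrDr; apply: (distance_gap ab _ _ _ nt0 H0).
- by rewrite -n4E; exact: le_trans ap (ler_wpM2l ne0 LA).
- by rewrite -n4E; exact: le_trans bq (ler_wpM2l ne0 LB).
- by rewrite mulrA.
Qed.

End adv_bound.

Theorem theorem3p5 :
  forall R : realType, exists c : R, 0 < c /\
  forall (d : measure_display) (X : measurableType d)
         (mu : {measure set X -> \bar R}) (P Q : X -> R) (eps : R)
         (k : forall n, n.-tuple X -> R) (e' : R) (n0 : nat),
    is_density mu P -> is_density mu Q -> 0 < eps ->
    is_test k -> is_DP eps k -> distinguishes mu P Q k ->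
    is_SC mu P Q k n0 ->
    let P0 := nameP mu P Q eps in
    let Q0 := nameQ mu P Q eps in
    is_eps' mu P0 Q0 eps e' ->
    c / (eps * tau mu P Q eps
         + hellinger2 mu (P' mu P0 Q0 eps) (Q' mu P0 Q0 eps e'))
      <= n0%:R.
Proof.
move=> R; exists (1 / 24); split=> [|d X mu P Q eps k e' n0]; first by lra.
move=> dP dQ eps0 tk dpk _ [/(_ n0 (leqnn n0)) advPQ _] P0 Q0 [_ e'E _].
have [dP0 dQ0] : is_density mu P0 /\ is_density mu Q0.
  by rewrite /P0 /Q0 /nameP /nameQ; case: ifP.
have -> : tau mu P Q eps = hockey mu P0 Q0 eps.
  rewrite /tau /P0 /Q0 /nameP /nameQ; case: ifPn => [/max_l//|].
  by rewrite -ltNge => /ltW/max_r.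
(* The absolute value absorbs the possible exchange of names between [P] and [Q]. *)
have adv0 : 2 / 3 <= `|prod_mean mu P0 (k n0) - prod_mean mu Q0 (k n0)|.
  rewrite /P0 /Q0 /nameP /nameQ; case: ifP => _; last rewrite distrC.
    exact: le_trans advPQ (ler_norm _).
  exact: le_trans advPQ (ler_norm _).
have := adv_rate dP0 dQ0 eps0 tk dpk e'E adv0.
have := rate_ge0 mu P0 Q0 e' eps0.
(* If [D = 0], the quotient is [0] by the convention on division, and the bound is immediate. *)
set D := _ + _; rewrite le_eqVlt => /predU1P[<- _|D_gt0 ?]; last by rewrite ler_pdivrMr.
by rewrite invr0 mulr0.
Qed.
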